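(* Let $G\colon\mathbb{R}^n\to\mathbb{R}^m$ be continuously differentiable, let $K:=\bigcup_{i=1}^pD_i$ be the union of finitely many convex polyhedral sets $D_1,\ldots,D_p\subset\mathbb{R}^m$, and let $\bar x\in M:=\{x\in\mathbb{R}^n\mid G(x)\in K\}$. Define $\mathcal{K}\colon\mathbb{R}^n\rightrightarrows\mathbb{R}^n$ by $$\mathcal{K}(x):=G'(x)^\top\mathcal{N}_K(G(\bar x))\qquad\text{for all }x\in\mathbb{R}^n.$$ Then $\bar x$ is AM-regular if and only if $$\limsup_{x\to\bar x}\mathcal{K}(x)\subset\mathcal{K}(\bar x).$$
   Context: Normal cones: for a set $A\subset\mathbb{R}^d$ and $\bar a\in A$, the tangent (Bouligand) cone is $\mathcal{T}_A(\bar a):=\{d\mid \exists t_k\searrow 0,\ d_k\to d\colon \bar a+t_kd_k\in A\ \forall k\}$, the regular normal cone is its polar $\widehat{\mathcal{N}}_A(\bar a):=\{v\mid v^\top d\le 0\ \forall d\in\mathcal{T}_A(\bar a)\}$, and the limiting normal cone is $\mathcal{N}_A(\bar a):=\{v\mid\exists a_k\to\bar a,\ a_k\in A,\ v_k\to v,\ v_k\in\widehat{\mathcal{N}}_A(a_k)\ \forall k\}$. All these sets are empty at points outside $A$. $G'(x)\in\mathbb{R}^{m\times n}$ is the Jacobian. Outer limit: for a set-valued mapping $\Upsilon$, $\limsup_{u\to\bar u}\Upsilon(u)$ is the set of all $v$ for which there are sequences $u_k\to\bar u$, $v_k\to v$ with $v_k\in\Upsilon(u_k)$ for all $k\in\mathbb{N}$.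 AM-regularity: for $\Phi\colon\mathbb{R}^n\rightrightarrows\mathbb{R}^m$ with closed graph and $0\in\Phi(\bar x)$, put $\mathcal{M}(x,y):=\bigcup_{\lambda\in\mathbb{R}^m}D^*\Phi(x,y)(\lambda)$, where $D^*\Phi(x,y)(\lambda):=\{x^*\mid(x^*,-\lambda)\in\mathcal{N}_{\operatorname{gph}\Phi}(x,y)\}$ and $\operatorname{gph}\Phi:=\{(x,y)\mid y\in\Phi(x)\}$. The point $\bar x$ is AM-regular if $\limsup_{x\to\bar x,\,y\to0}\mathcal{M}(x,y)\subset\mathcal{M}(\bar x,0)$. Here this is applied to $\Phi(x):=G(x)-K$, for which $\mathcal{M}(x,y)=G'(x)^\top\mathcal{N}_K(G(x)-y)$ for all $x\in\mathbb{R}^n$, $y\in\mathbb{R}^m$. *)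

(* Defs.v *)
(* Vectors of R^n are row vectors 'rV[R]_n, so that v^T d is (v *m d^T) 0 0
   and B^T l, for an m x n matrix B, is the row vector l *m B.
   R^n x R^m is identified with R^(n + m) through row_mx. *)
From HB Require Import structures.
From mathcomp Require Import all_boot all_order all_algebra.
From mathcomp Require Import all_classical all_reals all_analysis.

Set Implicit Arguments.
Unset Strict Implicit.
Unset Printing Implicit Defensive.

Import Order.TTheory GRing.Theory Num.Theory.
Import numFieldNormedType.Exports.

Local Open Scope classical_set_scope.
Local Open Scope ring_scope.

Definition outer_limit (U V : topologicalType) (Y : U -> set V) (ubar : U) :
    set V :=
  [set v | exists (u_ : nat -> U) (v_ : nat -> V),
    [/\ u_ @ \oo --> ubar, v_ @ \oo --> v & forall k, Y (u_ k) (v_ k)]].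

Section NormalCones.
Variables (R : realType) (d : nat).
Implicit Types (A : set 'rV[R]_d) (a : 'rV[R]_d).

Definition dotv (v w : 'rV[R]_d) : R := (v *m w^T) 0 0.

Definition tangent_cone A a : set 'rV[R]_d :=
  [set w | A a /\
    exists (t_ : nat -> R) (w_ : nat -> 'rV[R]_d),
      [/\ forall k, 0 < t_ k, t_ @ \oo --> (0 : R), w_ @ \oo --> w &
          forall k, A (a + t_ k *: w_ k)]].

(* The conjunct A a is needed: the polar of an empty cone is everything. *)
Definition regular_normal_cone A a : set 'rV[R]_d :=
  [set v | A a /\ forall w, tangent_cone A a w -> dotv v w <= 0].

Definition limiting_normal_cone A a : set 'rV[R]_d :=
  [set v | A a /\
    exists (a_ v_ : nat -> 'rV[R]_d),
      [/\ a_ @ \oo --> a, forall k, A (a_ k), v_ @ \oo --> v &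
          forall k, regular_normal_cone A (a_ k) (v_ k)]].

Definition convex_polyhedral A : Prop :=
  exists (q : nat) (c : 'I_q -> 'rV[R]_d) (b : 'I_q -> R),
    A = [set y | forall j, dotv (c j) y <= b j].

End NormalCones.

Section AMRegularity.
Variables (R : realType) (n m : nat).
Implicit Types Phi : 'rV[R]_n -> set 'rV[R]_m.

Definition gph Phi : set 'rV[R]_(n + m) :=
  [set z | Phi (lsubmx z) (rsubmx z)].

Definition coderivative Phi (x : 'rV[R]_n) (y lambda : 'rV[R]_m) :
    set 'rV[R]_n :=
  [set xs | limiting_normal_cone (gph Phi) (row_mx x y) (row_mx xs (- lambda))].

Definition AM_map Phi (x : 'rV[R]_n) (y : 'rV[R]_m) : set 'rV[R]_n :=
  \bigcup_(lambda in [set: 'rV[R]_m]) coderivative Phi x y lambda.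

(* Meant for Phi with closed graph and Phi xbar 0. *)
Definition AM_regular Phi (xbar : 'rV[R]_n) : Prop :=
  outer_limit (fun u : 'rV[R]_n * 'rV[R]_m => AM_map Phi u.1 u.2) (xbar, 0)
    `<=` AM_map Phi xbar 0.

End AMRegularity.

Section Constraints.
Variables (R : realType) (n m : nat) (G : 'rV[R]_n -> 'rV[R]_m).

(* The library's 'J acts on row vectors, 'd G x v = v *m 'J G x, hence is
   the transpose of the usual m x n Jacobian. *)
Definition Jac (x : 'rV[R]_n) : 'M[R]_(m, n) := ('J G x)^T.

Definition continuously_differentiable : Prop :=
  (forall x, differentiable G x) /\ continuous Jac.

Definition constraint_map (K : set 'rV[R]_m) (x : 'rV[R]_n) : set 'rV[R]_m :=
  [set G x - k | k in K].

Definition frozen_normal_map (K : set 'rV[R]_m) (xbar x : 'rV[R]_n) :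
    set 'rV[R]_n :=
  [set l *m Jac x | l in limiting_normal_cone K (G xbar)].

End Constraints.

(* Main.v *)
(** The graph of [x |-> G x - K] is the preimage of [K] under the submersion
    [(x, y) |-> G x - y], which yields
    [AM_map x y = (G' x)^T N_K(G x - y)] without any constraint qualification.
    If [xbar] is AM-regular, the frozen map is controlled by taking
    [y := G x - G xbar].  Conversely, near [G xbar] a finite union of polyhedra
    coincides with a translated cone, so that regular normals at [G xbar + h]
    are regular normals at [G xbar + s h] for all small [s > 0]; letting [s]
    tend to 0 gives [N_K(z) `<=` N_K(G xbar)] for [z] near [G xbar]. *)
Require Import Defs.
From mathcomp Require Import all_boot all_order all_algebra.
From mathcomp Require Import all_classical all_reals all_analysis.
From mathcomp Require Import lra.

Set Implicit Arguments.
Unset Strict Implicit.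
Unset Printing Implicit Defensive.

Import Order.TTheory GRing.Theory Num.Theory.
Import numFieldNormedType.Exports.
Local Open Scope classical_set_scope.
Local Open Scope ring_scope.

(** * Limits of matrix-valued maps and of difference quotients *)

Lemma cvg_mx (R : realType) (m n : nat) (T : Type) (F : set_system T)
    {FF : Filter F} (f : T -> 'M[R]_(m, n)) (A : 'M[R]_(m, n)) :
  (forall i j, f x i j @[x --> F] --> A i j) -> f @ F --> A.
Proof.
move=> fA B [P AP sPB]; rewrite /nbhs/=.
near=> x; apply: sPB => i j; move: i j.
near: x; apply: filter_forall => i; apply: filter_forall => j.
exact: fA (AP i j).
Unshelve. all: by end_near. Qed.

Lemma cvg_mulmx (R : realType) (m n p : nat) (T : Type) (F : set_system T)
    {FF : Filter F} (f : T -> 'M[R]_(m, n)) (g : T -> 'M[R]_(n, p))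
    (A : 'M[R]_(m, n)) (B : 'M[R]_(n, p)) :
  f @ F --> A -> g @ F --> B -> f x *m g x @[x --> F] --> A *m B.
Proof.
move=> fA gB; apply: cvg_mx => i j; rewrite mxE.
under eq_cvg do rewrite mxE.
apply: cvg_big => [|k _]; first exact: add_continuous.
by apply: cvgM; [exact: (cvg_comp _ _ fA (@coord_continuous _ _ _ i k A))
                |exact: (cvg_comp _ _ gB (@coord_continuous _ _ _ k j B))].
Qed.

Lemma cvg_row_mx (R : realType) (m n1 n2 : nat) (T : Type) (F : set_system T)
    {FF : Filter F} (f : T -> 'M[R]_(m, n1)) (g : T -> 'M[R]_(m, n2))
    (A : 'M[R]_(m, n1)) (B : 'M[R]_(m, n2)) :
  f @ F --> A -> g @ F --> B -> row_mx (f x) (g x) @[x --> F] --> row_mx A B.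
Proof.
move=> fA gB; apply: cvg_mx => i j; case: (split_ordP j) => k ->;
  rewrite ?row_mxEl ?row_mxEr.
  under eq_cvg do rewrite row_mxEl.
  exact: (cvg_comp _ _ fA (@coord_continuous _ _ _ i k A)).
under eq_cvg do rewrite row_mxEr.
exact: (cvg_comp _ _ gB (@coord_continuous _ _ _ i k B)).
Qed.

Lemma cvg_dotv (R : realType) (d : nat) (T : Type) (F : set_system T)
    {FF : Filter F} (v : 'rV[R]_d) (f : T -> 'rV[R]_d) (w : 'rV[R]_d) :
  f @ F --> w -> dotv v (f x) @[x --> F] --> dotv v w.
Proof.
move=> fw; have fTw : (f x)^T @[x --> F] --> w^T.
  apply: cvg_mx => i j; rewrite mxE; under eq_cvg do rewrite mxE.
  exact: (cvg_comp _ _ fw (@coord_continuous _ _ _ j i w)).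
have vfw : v *m (f x)^T @[x --> F] --> v *m w^T.
  by apply: cvg_mulmx => //; exact: cvg_cst.
exact: (cvg_comp _ _ vfw (@coord_continuous _ _ _ 0 0 _)).
Qed.

(** The directions [u_ k] vary, so a directional derivative is not enough. The quotient splits into
    the first-order remainder divided by [t_ k], which vanishes because [u_] is eventually bounded,
    and ['d f x (u_ k)], which converges by continuity of the differential. *)
Lemma cvg_difference_quotient (R : realType) (V W : normedModType R)
    (f : V -> W) (x u : V) (t_ : nat -> R) (u_ : nat -> V) :
    differentiable f x -> (forall k, 0 < t_ k) -> t_ @ \oo --> (0 : R) ->
    u_ @ \oo --> u ->
  (t_ k)^-1 *: (f (x + t_ k *: u_ k) - f x) @[k --> \oo] --> 'd f x u.
Proof.
move=> df t_gt0 t0 cu; have [dc dE] := (diff_locallyxP _ _).1 df.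
pose o h := f (x + h) - f x - 'd f x h.
have o0 e : 0 < e -> \forall h \near (0 : V), `|o h| <= e * `|h|.
  move=> e0; near=> h; rewrite /o [x + h]addrC dE.
  rewrite -[f x + _ + _]addrA [f x + _]addrC addrK ['d f x h + _]addrC addrK.
  by near: h; exact: littleoP.
have qE k : (t_ k)^-1 *: (f (x + t_ k *: u_ k) - f x) =
    (t_ k)^-1 *: o (t_ k *: u_ k) + 'd f x (u_ k).
  rewrite /o linearZ/= [in RHS]scalerBr scalerA mulVf ?gt_eqF//.
  by rewrite scale1r subrK.
under eq_cvg do rewrite qE.
rewrite -['d f x u]add0r; apply: cvgD; last first.
  exact: (cvg_comp _ _ cu (dc u)).
have tu0 : t_ k *: u_ k @[k --> \oo] --> (0 : V).
  by rewrite -(scale0r u); apply: cvgZ.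
(* Adding 1 gives a positive eventual bound on the norms of [u_ k], even when [u = 0], so that [e]
   can be divided by it. *)
have u1 : 0 < `|u| + 1 by rewrite ltr_wpDl.
apply/cvgr0Pnorm_le => e e0; near=> k.
have uk : `|u_ k| <= `|u| + 1.
  by near: k; apply: cvgr_norm_le cu _ _; rewrite ltrDl.
have oe : `|o (t_ k *: u_ k)| <= (e / (`|u| + 1)) * `|t_ k *: u_ k|.
  by near: k; exact: (tu0 _ (o0 _ (divr_gt0 e0 u1))).
rewrite normrZ normfV (gtr0_norm (t_gt0 k)) ler_pdivrMl//.
rewrite (le_trans oe)// normrZ (gtr0_norm (t_gt0 k)) mulrCA.
by rewrite ler_pM2l// -mulrA ler_piMr ?(ltW e0)// mulrC ler_pdivrMr// mul1r.
Unshelve. all: by end_near. Qed.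

(** * Tangent and normal cones of locally conic sets *)

Lemma tangent_cone_near (R : realType) (d : nat) (A : set 'rV[R]_d)
    (a w : 'rV[R]_d) (t_ : nat -> R) (w_ : nat -> 'rV[R]_d) :
    A a -> (forall k, 0 < t_ k) -> t_ @ \oo --> (0 : R) -> w_ @ \oo --> w ->
    (\forall k \near \oo, A (a + t_ k *: w_ k)) ->
  tangent_cone A a w.
Proof.
move=> Aa t_gt0 t0 ww [N _ NA]; split => //.
(* The definition asks for membership at every index, so the first [N] terms are dropped. *)
exists (fun k => t_ (k + N)%N), (fun k => w_ (k + N)%N); split.
- by move=> k; exact: t_gt0.
- by rewrite (@cvg_shiftn N _ t_).
- by rewrite (@cvg_shiftn N _ w_).
- by move=> k; apply: NA => /=; rewrite leq_addl.
Qed.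

(** Within radius [e] of [a], the set agrees with a translated cone with apex [a]. The bound
    [s <= 1] keeps the scaled point [s *: h] inside the ball. *)
Definition locally_conic (R : realType) (V : normedModType R) (A : set V)
    (a : V) (e : R) :=
  forall h s, `|h| < e -> 0 < s -> s <= 1 -> A (a + s *: h) <-> A (a + h).

(** Since [a + s *: h + t *: w = a + s *: (h + (s^-1 * t) *: w)], scaling away [s] keeps the
    directions [w_] and only changes the step lengths from [t_ k] to [s^-1 * t_ k]. Polarity then
    reverses the inclusion for regular normals. *)
Lemma tangent_cone_conic (R : realType) (d : nat) (A : set 'rV[R]_d)
    (a h : 'rV[R]_d) (e s : R) :
    locally_conic A a e -> `|h| < e -> 0 < s -> s <= 1 ->
  tangent_cone A (a + s *: h) `<=` tangent_cone A (a + h).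
Proof.
move=> cA he s0 s1 w [Aash [t_ [w_ [t_gt0 t0 ww Atw]]]].
have ts0 : (fun k => s^-1 * t_ k) @ \oo --> (0 : R).
  by rewrite -(mulr0 s^-1); apply: cvgM => //; exact: cvg_cst.
apply: (@tangent_cone_near _ _ _ _ _ (fun k => s^-1 * t_ k) w_) => //.
- exact/(cA h s).
- by move=> k; rewrite mulr_gt0 ?invr_gt0.
(* The conic property is applied at these points, so they must eventually lie in the ball of radius
   [e]; the strict bound on [h] ensures this. *)
have hw : (fun k => h + (s^-1 * t_ k) *: w_ k) @ \oo --> h.
  rewrite -[X in _ --> X]addr0 -(scale0r w).
  by apply: cvgD; [exact: cvg_cst | exact: cvgZ].
near=> k; rewrite -addrA; apply/(cA _ s) => //.
  by near: k; apply: cvgr_norm_lt hw _ he.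
by rewrite scalerDr addrA scalerA mulrA divff ?mul1r ?gt_eqF//.
Unshelve. all: by end_near. Qed.

Lemma regular_normal_cone_conic (R : realType) (d : nat) (A : set 'rV[R]_d)
    (a h : 'rV[R]_d) (e s : R) :
    locally_conic A a e -> `|h| < e -> 0 < s -> s <= 1 ->
  regular_normal_cone A (a + h) `<=` regular_normal_cone A (a + s *: h).
Proof.
move=> cA he s0 s1 v [Aah vT]; split; first exact/cA.
by move=> w /(tangent_cone_conic cA he s0 s1); exact: vT.
Qed.

Lemma limiting_normal_cone_near (R : realType) (d : nat) (A : set 'rV[R]_d)
    (a v : 'rV[R]_d) (a_ v_ : nat -> 'rV[R]_d) :
    A a -> a_ @ \oo --> a -> v_ @ \oo --> v ->
    (\forall k \near \oo, regular_normal_cone A (a_ k) (v_ k)) ->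
  limiting_normal_cone A a v.
Proof.
move=> Aa aa vv [N _ NA]; split => //.
have {}NA k : regular_normal_cone A (a_ (k + N)%N) (v_ (k + N)%N).
  by apply: NA => /=; rewrite leq_addl.
exists (fun k => a_ (k + N)%N), (fun k => v_ (k + N)%N); split => //.
- by rewrite (@cvg_shiftn N _ a_).
- by move=> k; have [] := NA k.
- by rewrite (@cvg_shiftn N _ v_).
Qed.

Lemma limiting_normal_cone_conic (R : realType) (d : nat) (A : set 'rV[R]_d)
    (a h : 'rV[R]_d) (e : R) :
    A a -> locally_conic A a e -> `|h| < e ->
  limiting_normal_cone A (a + h) `<=` limiting_normal_cone A a.
Proof.
move=> Aa cA he v [Aah [a_ [v_ [aa Aa_ vv vN]]]].
have ha : (fun k => a_ k - a) @ \oo --> h.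
  have -> : h = a + h - a by rewrite addrC addKr.
  by apply: cvgB => //; exact: cvg_cst.
(* Each base point is pulled towards [a] by the factor [harmonic k], which lies in (0, 1] and tends
   to 0. The normals [v_] are unchanged, so their limit is still [v]. *)
apply: (@limiting_normal_cone_near _ _ _ _ _
  (fun k => a + harmonic k *: (a_ k - a)) v_) => //.
  rewrite -[X in _ --> X]addr0 -(scale0r h).
  by apply: cvgD; [exact: cvg_cst | apply: cvgZ => //; exact: cvg_harmonic].
near=> k; apply: (regular_normal_cone_conic cA); last first.
- by rewrite addrC subrK; exact: vN.
- by rewrite /= invf_le1 ?ler1n ?ltr0n.
- exact: harmonic_gt0.
- by near: k; apply: cvgr_norm_lt ha _ he.
Unshelve. all: by end_near. Qed.

(** * Finite unions of polyhedra are locally conic *)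

Lemma halfspace_near_conic (R : realType) (d : nat) (c a : 'rV[R]_d) (b : R) :
  \forall h \near (0 : 'rV[R]_d), forall s : R, 0 < s -> s <= 1 ->
    dotv c (a + s *: h) <= b <-> dotv c (a + h) <= b.
Proof.
have dE (h : 'rV[R]_d) (s : R) : dotv c (a + s *: h) = dotv c a + s * dotv c h.
  by rewrite /dotv linearD linearZ mulmxDr -scalemxAr !mxE.
have d0 : dotv c h @[h --> (0 : 'rV[R]_d)] --> (0 : R).
  have <- : dotv c 0 = 0 by rewrite /dotv trmx0 mulmx0 mxE.
  exact: (@cvg_dotv R d _ (nbhs (0 : 'rV[R]_d)) _ c id 0 cvg_id).
(* An inequality that is slack or violated at [a] keeps that status nearby, so the equivalence holds
   trivially. An active one reduces to the sign of [dotv c h], which positive scaling preserves. *)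
have [ab|ab|<-] := ltgtP (dotv c a) b.
- near=> h => s s0 s1.
  have hd : `|dotv c h| < b - dotv c a.
    by near: h; apply: cvgr0_norm_lt => //; rewrite subr_gt0.
  have sd : s * dotv c h < b - dotv c a.
    apply: le_lt_trans hd; rewrite (le_trans (ler_norm _))// normrM.
    by rewrite ler_piMl// ger0_norm// ltW.
  rewrite dE -[in dotv c (a + h)](scale1r h) dE mul1r.
  have := le_lt_trans (ler_norm _) hd.
  by split => _; lra.
- near=> h => s s0 s1.
  have hd : `|dotv c h| < dotv c a - b.
    by near: h; apply: cvgr0_norm_lt => //; rewrite subr_gt0.
  have sd : `|s * dotv c h| < dotv c a - b.
    apply: le_lt_trans hd; rewrite normrM.
    by rewrite ler_piMl// ger0_norm// ltW.
  rewrite dE -[in dotv c (a + h)](scale1r h) dE mul1r.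
  move: hd sd; rewrite !ltr_norml => /andP[h1 h2] /andP[h3 h4].
  by split => h5; lra.
- near=> h => s s0 s1.
  rewrite dE -[in dotv c (a + h)](scale1r h) dE mul1r.
  by rewrite !gerDl pmulr_rle0.
Unshelve. all: by end_near. Qed.

(** Finitely many inequalities describe all the [D i], so the intersection of their neighbourhoods
    is again one. The equivalence, valid for each [D i] separately, passes to the union. *)
Lemma polyhedral_union_conic (R : realType) (d p : nat)
    (D : 'I_p -> set 'rV[R]_d) (a : 'rV[R]_d) :
    (forall i, convex_polyhedral (D i)) ->
  exists2 e, 0 < e & locally_conic (\bigcup_(i in [set: 'I_p]) D i) a e.
Proof.
move=> hD.
suff /nbhs_ballP[e /= e0 De] : \forall h \near (0 : 'rV[R]_d),
    forall i (s : R), 0 < s -> s <= 1 -> D i (a + s *: h) <-> D i (a + h).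
  exists e => // h s he s0 s1.
  have hB : ball (0 : 'rV[R]_d) e h.
    by rewrite -ball_normE /ball_/= sub0r normrN.
  by split => -[i _ Di]; exists i => //; exact/(De h hB i s).
apply: (@filter_forall _ _ _ (nbhs (0 : 'rV[R]_d))) => i.
have [q [c [b ->]]] := hD i.
have : \forall h \near (0 : 'rV[R]_d), forall j (s : R), 0 < s -> s <= 1 ->
    (dotv (c j) (a + s *: h) <= b j) <-> (dotv (c j) (a + h) <= b j).
  apply: (@filter_forall _ _ _ (nbhs (0 : 'rV[R]_d))) => j.
  exact: halfspace_near_conic.
apply: filterS => h H s s0 s1.
by split => /= Hc j; apply/(H j s s0 s1).
Qed.

(** * Tangents and normals to the graph of [constraint_map G K] *)

Lemma gph_constraint_mapE (R : realType) (n m : nat) (G : 'rV[R]_n -> 'rV[R]_m)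
    (K : set 'rV[R]_m) (x : 'rV[R]_n) (y : 'rV[R]_m) :
  gph (constraint_map G K) (row_mx x y) <-> K (G x - y).
Proof.
rewrite /gph /= row_mxKl row_mxKr; split => [[k Kk <-]|Kxy].
  by rewrite subKr.
by exists (G x - y) => //; rewrite subKr.
Qed.

(** The map [(x, y) |-> G x - y] has differential [(u, w) |-> u *m 'J G x - w], and it is onto
    through [y] alone. Sequences in [K] therefore lift to the graph by adjusting [y]. *)
Lemma tangent_cone_gphE (R : realType) (n m : nat) (G : 'rV[R]_n -> 'rV[R]_m)
    (K : set 'rV[R]_m) (x u : 'rV[R]_n) (y w : 'rV[R]_m) :
    differentiable G x ->
  tangent_cone (gph (constraint_map G K)) (row_mx x y) (row_mx u w) <->
  tangent_cone K (G x - y) (u *m 'J G x - w).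
Proof.
move=> dG; have dGE (t_ : nat -> R) (u_ : nat -> 'rV[R]_n) :
    (forall k, 0 < t_ k) -> t_ @ \oo --> (0 : R) -> u_ @ \oo --> u ->
    (t_ k)^-1 *: (G (x + t_ k *: u_ k) - G x) @[k --> \oo] --> u *m 'J G x.
  rewrite /jacobian mul_rV_lin1.
  exact: cvg_difference_quotient.
split=> [[/gph_constraint_mapE Kxy [t_ [z_ [t_gt0 t0 zz Ktz]]]]|
         [Kxy [t_ [h_ [t_gt0 t0 hh Kth]]]]].
  have uu : (fun k => lsubmx (z_ k)) @ \oo --> u.
    rewrite -[u](row_mxKl u w).
    exact: (cvg_comp _ _ zz (@continuous_lsubmx _ _ _ _ _)).
  have ww : (fun k => rsubmx (z_ k)) @ \oo --> w.
    rewrite -[w](row_mxKr u w).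
    exact: (cvg_comp _ _ zz (@continuous_rsubmx _ _ _ _ _)).
  split=> //; exists t_, (fun k =>
    (t_ k)^-1 *: (G (x + t_ k *: lsubmx (z_ k)) - G x) - rsubmx (z_ k)).
  split=> // [|k]; first by apply: cvgB => //; exact: dGE.
  have := Ktz k; rewrite -[z_ k in X in X -> _]hsubmxK scale_row_mx add_row_mx.
  move=> /gph_constraint_mapE; congr (K _).
  rewrite scalerBr scalerA divff ?gt_eqF// scale1r.
  rewrite opprD !addrA; congr (_ - _).
  by rewrite [RHS]addrAC [G x - y - _]addrAC subrr add0r addrC.
split; first exact/gph_constraint_mapE.
(* The direction in [x] stays [u]; the one in [y] absorbs the nonlinearity of [G], so that the
   lifted point is sent exactly to [G x - y + t_ k *: h_ k]. *)
exists t_, (fun k =>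
  row_mx u ((t_ k)^-1 *: (G (x + t_ k *: u) - G x) - h_ k)); split => // [|k].
  apply: cvg_row_mx; first exact: cvg_cst.
  rewrite -[w](subKr (u *m 'J G x)); apply: cvgB => //.
  by apply: dGE => //; exact: cvg_cst.
rewrite scale_row_mx add_row_mx; apply/gph_constraint_mapE.
have := Kth k; congr (K _).
rewrite scalerBr scalerA divff ?gt_eqF// scale1r.
rewrite !opprD !opprK !addrA; congr (_ + _).
by rewrite [_ - y - _]addrAC subrr add0r addrC.
Qed.

Lemma dotv_row_mxN (R : realType) (n m : nat) (u v : 'rV[R]_n)
    (l w : 'rV[R]_m) :
  dotv (row_mx v (- l)) (row_mx u w) = dotv v u - dotv l w.
Proof. by rewrite /dotv tr_row_mx mul_row_col mulNmx !mxE. Qed.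

Lemma dotv_jacobian (R : realType) (n m : nat) (G : 'rV[R]_n -> 'rV[R]_m)
    (x u : 'rV[R]_n) (l : 'rV[R]_m) :
  dotv l (u *m 'J G x) = dotv (l *m Jac G x) u.
Proof. by rewrite /dotv trmx_mul mulmxA. Qed.

Lemma dotvB (R : realType) (d : nat) (v w1 w2 : 'rV[R]_d) :
  dotv v (w1 - w2) = dotv v w1 - dotv v w2.
Proof. by rewrite /dotv linearB mulmxBr !mxE. Qed.

(** Tangents to the graph are the pairs [(u, u *m 'J G x - h)] with [u] free and [h] tangent to [K].
    Polarity thus separates: [u] forces [v = l *m Jac G x], and [h] makes [l] a regular normal to
    [K]. *)
Lemma regular_normal_cone_gphE (R : realType) (n m : nat)
    (G : 'rV[R]_n -> 'rV[R]_m) (K : set 'rV[R]_m)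
    (x v : 'rV[R]_n) (y l : 'rV[R]_m) :
    differentiable G x ->
  regular_normal_cone (gph (constraint_map G K)) (row_mx x y) (row_mx v (- l))
  <-> regular_normal_cone K (G x - y) l /\ v = l *m Jac G x.
Proof.
move=> dG; split=> [[/gph_constraint_mapE Kxy vT]|[[Kxy lT] ->]].
  have {}vT u h : tangent_cone K (G x - y) h ->
      dotv v u - dotv (l *m Jac G x) u + dotv l h <= 0.
    move=> Th; have := vT (row_mx u (u *m 'J G x - h)).
    rewrite dotv_row_mxN dotvB dotv_jacobian opprB addrA addrAC; apply.
    by apply/tangent_cone_gphE => //; rewrite subKr.
  (* For h = 0, [vT] says that a linear form in u is never positive, so it is 0. *)
  have T0 : tangent_cone K (G x - y) 0.
    apply: (@tangent_cone_near _ _ _ _ _ harmonic (fun=> 0)) => //.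
    - by move=> k; exact: harmonic_gt0.
    - exact: cvg_harmonic.
    - exact: cvg_cst.
    - by near=> k; rewrite scaler0 addr0.
  have dotv0 k (a : 'rV[R]_k) : dotv a 0 = 0.
    by rewrite /dotv trmx0 mulmx0 mxE.
  split; first by split=> // h /(vT 0); rewrite !dotv0 subr0 add0r.
  have vJ u : dotv (v - l *m Jac G x) u <= 0.
    by have := vT u _ T0; rewrite dotv0 addr0 /dotv mulmxBl !mxE.
  apply/eqP; rewrite -subr_eq0; apply/eqP.
  move: (v - _) vJ => z vJ; have := vJ z.
  rewrite /dotv mxE => z0; apply/rowP => i; rewrite [RHS]mxE.
  have /eqP : \sum_j z 0 j * z^T j 0 == 0.
    by rewrite eq_le z0/= sumr_ge0// => j _; rewrite mxE -expr2 sqr_ge0.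
  move=> /psumr_eq0P => /(_ (fun j _ => _)) -/(_ _ i isT).
  rewrite mxE => H; apply/eqP; rewrite -sqrf_eq0 expr2; apply/eqP; apply: H.
  by move=> j; rewrite mxE -expr2 sqr_ge0.
split; first exact/gph_constraint_mapE.
move=> z; rewrite -[z]hsubmxK => /tangent_cone_gphE -/(_ dG) /lT.
by rewrite dotvB dotv_jacobian dotv_row_mxN.
Unshelve. all: by end_near. Qed.

Lemma limiting_normal_cone_gphE (R : realType) (n m : nat)
    (G : 'rV[R]_n -> 'rV[R]_m) (K : set 'rV[R]_m)
    (x v : 'rV[R]_n) (y l : 'rV[R]_m) :
    continuously_differentiable G ->
  limiting_normal_cone (gph (constraint_map G K)) (row_mx x y) (row_mx v (- l))
  <-> limiting_normal_cone K (G x - y) l /\ v = l *m Jac G x.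
Proof.
move=> [dG cJ]; split=> [|[[Kxy [z_ [l_ [zz Kz ll lN]]]] ->]].
  move=> [/gph_constraint_mapE Kxy [a_ [b_ [aa Ka bb bN]]]].
  have xx : (fun k => lsubmx (a_ k)) @ \oo --> x.
    rewrite -[x](row_mxKl x y).
    exact: (cvg_comp _ _ aa (@continuous_lsubmx _ _ _ _ _)).
  have yy : (fun k => rsubmx (a_ k)) @ \oo --> y.
    rewrite -[y](row_mxKr x y).
    exact: (cvg_comp _ _ aa (@continuous_rsubmx _ _ _ _ _)).
  have vv : (fun k => lsubmx (b_ k)) @ \oo --> v.
    rewrite -[v](row_mxKl v (- l)).
    exact: (cvg_comp _ _ bb (@continuous_lsubmx _ _ _ _ _)).
  have ll : (fun k => - rsubmx (b_ k)) @ \oo --> l.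
    rewrite -[l]opprK; apply: cvgN; rewrite -[- l](row_mxKr v (- l)).
    exact: (cvg_comp _ _ bb (@continuous_rsubmx _ _ _ _ _)).
  have {}bN k : regular_normal_cone K (G (lsubmx (a_ k)) - rsubmx (a_ k))
        (- rsubmx (b_ k)) /\
      lsubmx (b_ k) = - rsubmx (b_ k) *m Jac G (lsubmx (a_ k)).
    by apply/regular_normal_cone_gphE => //; rewrite opprK !hsubmxK.
  split.
    split=> //; exists (fun k => G (lsubmx (a_ k)) - rsubmx (a_ k)),
      (fun k => - rsubmx (b_ k)); split => //.
    - apply: cvgB => //.
      exact: (cvg_comp _ _ xx (differentiable_continuous (dG x))).
    - by move=> k; have [[]] := bN k.
    - by move=> k; have [] := bN k.
  (* The formula for regular normals holds along the sequence; continuity of [Jac G] carries it to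
     the limit. *)
  apply: (cvg_unique _ vv); first exact: norm_hausdorff.
  rewrite (funext (fun k => (bN k).2)).
  by apply: cvg_mulmx => //; exact: (cvg_comp _ _ xx (cJ x)).
split; first exact/gph_constraint_mapE.
(* With [x] frozen, the choice [y_k := G x - z_ k] makes [G x - y_k] equal to the prescribed point
   [z_ k] of [K]. *)
exists (fun k => row_mx x (G x - z_ k)),
  (fun k => row_mx (l_ k *m Jac G x) (- l_ k)); split.
- apply: cvg_row_mx; first exact: cvg_cst.
  by rewrite -[y](subKr (G x)); apply: cvgB => //; exact: cvg_cst.
- by move=> k; apply/gph_constraint_mapE; rewrite subKr.
- apply: cvg_row_mx; last exact: cvgN.
  by apply: cvg_mulmx => //; exact: cvg_cst.
- by move=> k; apply/regular_normal_cone_gphE => //; rewrite subKr.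
Qed.

Lemma AM_map_constraintE (R : realType) (n m : nat)
    (G : 'rV[R]_n -> 'rV[R]_m) (K : set 'rV[R]_m) (x : 'rV[R]_n)
    (y : 'rV[R]_m) :
    continuously_differentiable G ->
  AM_map (constraint_map G K) x y =
  [set l *m Jac G x | l in limiting_normal_cone K (G x - y)].
Proof.
move=> cG; apply/seteqP; split=> v /=.
  by move=> [l _ /(limiting_normal_cone_gphE _ _ _ _ _ cG)[Nl ->]]; exists l.
move=> [l Nl <-]; exists l => //.
exact/(limiting_normal_cone_gphE _ _ _ _ _ cG).
Qed.

Theorem theorem5p3 (R : realType) (n m p : nat)
    (G : 'rV[R]_n -> 'rV[R]_m) (D : 'I_p -> set 'rV[R]_m)
    (K : set 'rV[R]_m) (xbar : 'rV[R]_n)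
    (hG : continuously_differentiable G)
    (hD : forall i, convex_polyhedral (D i))
    (hK : K = \bigcup_(i in [set: 'I_p]) D i)
    (hxbar : K (G xbar)) :
  AM_regular (constraint_map G K) xbar <->
  outer_limit (frozen_normal_map G K xbar) xbar
    `<=` frozen_normal_map G K xbar xbar.
Proof.
have GG (x_ : nat -> 'rV[R]_n) : x_ @ \oo --> xbar ->
    (fun k => G (x_ k)) @ \oo --> G xbar.
  move=> xx.
  exact: (cvg_comp _ _ xx (differentiable_continuous (hG.1 xbar))).
have AM0 : AM_map (constraint_map G K) xbar 0 = frozen_normal_map G K xbar xbar.
  by rewrite AM_map_constraintE// subr0.
rewrite /AM_regular AM0; split=> sub v.
  move=> [x_ [v_ [xx vv Kv]]]; apply: sub.
  (* With this second component, normals are taken at [G (x_ k) - y_k = G xbar] for every [k], and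
     [y_k] tends to 0 by continuity of [G]. *)
  exists (fun k => (x_ k, G (x_ k) - G xbar)), v_; split=> //.
    have y0 : (fun k => G (x_ k) - G xbar) @ \oo --> (0 : 'rV[R]_m).
      by rewrite -(subrr (G xbar)); apply: cvgB; [exact: GG | exact: cvg_cst].
    exact: (cvg_pair xx y0).
  by move=> k /=; rewrite AM_map_constraintE// subKr; exact: Kv.
move=> [u_ [v_ [uu vv Mv]]]; apply: sub.
have [e e0 cK] := polyhedral_union_conic (G xbar) hD.
have xx : (fun k => (u_ k).1) @ \oo --> xbar.
  exact: (cvg_comp _ _ uu (@cvg_fst _ _ _ _ _)).
have yy : (fun k => (u_ k).2) @ \oo --> (0 : 'rV[R]_m).
  exact: (cvg_comp _ _ uu (@cvg_snd _ _ _ _ _)).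
have h0 : (fun k => G (u_ k).1 - (u_ k).2 - G xbar) @ \oo --> (0 : 'rV[R]_m).
  have <- : G xbar - 0 - G xbar = 0 by rewrite subr0 subrr.
  by apply: cvgB; [apply: cvgB => //; exact: GG | exact: cvg_cst].
(* From index [N] on, the points [G x - y] lie in the ball around [G xbar] where [K] is conic, so
   their limiting normals belong to the cone at [G xbar]. *)
have [N _ hN] := cvgr0_norm_lt _ h0 _ e0.
exists (fun k => (u_ (k + N)%N).1), (fun k => v_ (k + N)%N); split.
- by rewrite (@cvg_shiftn N _ (fun k => (u_ k).1)).
- by rewrite (@cvg_shiftn N _ v_).
move=> k; have := Mv (k + N)%N; rewrite AM_map_constraintE// => -[l Nl <-].
exists l => //; rewrite -hK in cK.
apply: (limiting_normal_cone_conic hxbar cK (hN _ (leq_addl k N))).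
by rewrite addrC subrK.
Qed.
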